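(* Let $u\in C_0^\infty(\mathbb R^n)$ be real-valued, and let $p,q,n$ satisfy $0<q<2<p$ and $2<n<\frac{2(p-q)}{p-2}$. Then $$\int_{\mathbb R^n}|\Delta u(x)|^2\,dx \int_{\mathbb R^n}\frac{|\nabla u(x)|^{2p-2}}{|x|^{2q-2}}\,dx \;\geq\; \frac{(n-q)^2}{p^2}\left(\int_{\mathbb R^n}\frac{|\nabla u(x)|^p}{|x|^q}\,dx\right)^2 + \left(\int_{\mathbb R^n}\frac{|\nabla u(x)|^{p}}{|x|^{q-1}}\,|\Phi_{\nabla u}'(x)|\, dx\right)^2 .$$
   Context: $C_0^\infty(\mathbb R^n)$ denotes the smooth functions with compact support in $\mathbb R^n$; $\Delta$ is the Laplacian. Generalized phase derivative of a vector-valued $C^1$ function $f=(f_1,\dots,f_m)$ on $\mathbb R^n$ with real components and $|f|^2=\sum_j f_j^2$: at points where $f(x)\ne 0$, $$|\Phi_f'(x)|=\left(\sum_{k=1}^n\sum_{1\leq j<l\leq m}\left(\frac{f_l(x)}{|f(x)|^2}\partial_k f_j(x)-\frac{f_j(x)}{|f(x)|^2}\partial_k f_l(x)\right)^2\right)^{1/2}.$$ Here it is applied with $m=n$ and $f=\nabla u=(\partial_1u,\dots,\partial_nu)$. Integrands containing the product of a positive power of $|f(x)|$ with $|\Phi_f'(x)|$ are taken to be $0$ at points where $f(x)=0$. *)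

(* Defs.v *)
From HB Require Import structures.
From mathcomp Require Import all_boot all_order all_algebra.
From mathcomp Require Import all_classical all_reals all_analysis.

Set Implicit Arguments.
Unset Strict Implicit.
Unset Printing Implicit Defensive.

Import Order.TTheory GRing.Theory Num.Theory.
Import numFieldNormedType.Exports.

Local Open Scope classical_set_scope.
Local Open Scope ring_scope.

Fact rV_display : measure_display.
Proof. exact: default_measure_display. Qed.

Section rV_measurable.
Context {R : realType} (n : nat).

(* The sigma-algebra generated by the coordinates, i.e. the Borel
   sigma-algebra of R^n. *)
Let coord_rV : 'I_n -> 'rV[R]_n -> measurableTypeR R := fun i x => x ord0 i.

Let rV_set0 : g_sigma_preimage coord_rV set0.
Proof. exact: sigma_algebra0. Qed.

Let rV_setC A : g_sigma_preimage coord_rV A -> g_sigma_preimage coord_rV (~` A).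
Proof. exact: sigma_algebraC. Qed.

Let rV_bigcup (F : _^nat) : (forall i, g_sigma_preimage coord_rV (F i)) ->
  g_sigma_preimage coord_rV (\bigcup_i (F i)).
Proof. exact: sigma_algebra_bigcup. Qed.

HB.instance Definition _ := @isMeasurable.Build rV_display
  'rV[R]_n (g_sigma_preimage coord_rV) rV_set0 rV_setC rV_bigcup.

End rV_measurable.

Section lebesgue_measure_rV.
Context {R : realType}.

Lemma measurable_coord_rV n (i : 'I_n) :
  measurable_fun setT ((fun x : 'rV[R]_n => x ord0 i) : _ -> measurableTypeR R).
Proof.
move=> _ Y mY; rewrite setTI; apply: sub_sigma_algebra => /=.
rewrite -bigcup_seq/=; exists i => /=; first by rewrite mem_index_enum.
by exists Y => //; rewrite setTI.
Qed.

Lemma measurable_fun_rV d (T : measurableType d) n (f : T -> 'rV[R]_n) :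
  (forall i, measurable_fun setT ((fun t => f t ord0 i) : T -> measurableTypeR R)) ->
  measurable_fun setT f.
Proof.
move=> mf _ A mA; rewrite setTI.
have : g_sigma_preimage (fun i t => f t ord0 i : measurableTypeR R) `<=`
       (@measurable d T).
  apply: smallest_sub; first exact: sigma_algebra_measurable.
  rewrite -bigcup_seq/=; apply: bigcup_sub => i _ B [C mC <-].
  exact: mf.
apply.
have := @g_sigma_preimage_comp _ (measurableTypeR R) n
  ('rV[R]_n : pointedType) (fun i x => x ord0 i) T f.
rewrite /comp => ->.
by exists A => //; rewrite setTI.
Qed.

Definition cons_rV n (z : measurableTypeR R * 'rV[R]_n) : 'rV[R]_n.+1 :=
  \row_i oapp (fun j => z.2 ord0 j) (z.1 : R) (unlift ord0 i).

Lemma measurable_cons_rV n : measurable_fun setT (@cons_rV n).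
Proof.
apply: measurable_fun_rV => i.
case: (unliftP ord0 i) => [j|] ->.
  rewrite [X in measurable_fun _ X](_ : _ = (fun x : 'rV[R]_n => x ord0 j) \o snd).
    exact: measurableT_comp (measurable_coord_rV j) measurable_snd.
  by apply/funext => z; rewrite mxE liftK.
rewrite [X in measurable_fun _ X](_ : _ = fst)//.
by apply/funext => z; rewrite mxE unlift_none.
Qed.

Section step.
Variables (n : nat) (mu : {measure set 'rV[R]_n -> \bar R}).

Definition lebesgue_cons : set 'rV[R]_n.+1 -> \bar R :=
  pushforward (lebesgue_measure \x^ mu)%E (@cons_rV n).

Let lebesgue_cons0 : lebesgue_cons set0 = 0%E.
Proof. by rewrite /lebesgue_cons /pushforward preimage_set0 measure0. Qed.

Let mcons A : measurable A -> measurable (@cons_rV n @^-1` A).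
Proof. by move=> mA; rewrite -[X in measurable X]setTI; exact: measurable_cons_rV. Qed.

Let lebesgue_cons_ge0 A : (0 <= lebesgue_cons A)%E.
Proof. by rewrite /lebesgue_cons /pushforward measure_ge0. Qed.

Let lebesgue_cons_sigma_additive : semi_sigma_additive lebesgue_cons.
Proof.
move=> F mF tF mUF; rewrite /lebesgue_cons /pushforward preimage_bigcup.
apply: measure_semi_sigma_additive.
- by move=> k; exact: mcons.
- apply/trivIsetP => /= i j _ _ ij; rewrite -preimage_setI.
  by move/trivIsetP : tF => /(_ _ _ _ _ ij) ->//; rewrite preimage_set0.
- by rewrite -preimage_bigcup; exact: mcons.
Qed.

HB.instance Definition _ := isMeasure.Build _ _ _ lebesgue_cons
  lebesgue_cons0 lebesgue_cons_ge0 lebesgue_cons_sigma_additive.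
End step.

(* n-dimensional Lebesgue measure, as an n-fold product of lebesgue_measure;
   the value on boxes is lebesgue_measure_rV_box. *)
Fixpoint lebesgue_measure_rV n : {measure set 'rV[R]_n -> \bar R} :=
  if n is n'.+1 then lebesgue_cons (lebesgue_measure_rV n')
  else \d_ (0 : 'rV[R]_0).

Lemma lebesgue_measure_rV_box n (A : 'I_n -> set (measurableTypeR R)) :
  (forall i, measurable (A i)) ->
  lebesgue_measure_rV n [set x | forall i, A i (x ord0 i)] =
  (\prod_(i < n) lebesgue_measure (A i))%E.
Proof.
elim: n A => [A _|n ih A mA] /=.
  by rewrite big_ord0 diracE mem_set//= => -[].
rewrite big_ord_recl /= /lebesgue_cons /pushforward.
pose B := [set x : 'rV[R]_n | forall i, A (lift ord0 i) (x ord0 i)].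
have mB : measurable B.
  rewrite (_ : B = \bigcap_(i in [set: 'I_n])
      ((fun x : 'rV[R]_n => x ord0 i) @^-1` A (lift ord0 i))).
    apply: fin_bigcap_measurable => // i _.
    by rewrite -[X in measurable X]setTI; exact: measurable_coord_rV.
  by apply/seteqP; split => x h i; [move=> _|]; exact: h.
rewrite [X in (_ \x^ _)%E X](_ : _ = A ord0 `*` B).
  by rewrite product_measure2E//; congr (_ * _)%E; exact: ih.
apply/seteqP; split => [z h|z [h0 h] i].
  split => [|i]; first by have := h ord0; rewrite mxE unlift_none.
  by have := h (lift ord0 i); rewrite mxE liftK.
by rewrite mxE; case: (unliftP ord0 i) => [j|] ->; [exact: h|exact: h0].
Qed.

End lebesgue_measure_rV.

Section calculus.
Context {R : realType} {n : nat}.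
Implicit Types (u : 'rV[R]_n -> R) (x : 'rV[R]_n).

(* The library norm `|x| on 'rV[R]_n is the sup norm. *)
Definition enorm m (y : 'rV[R]_m) : R := Num.sqrt (\sum_(i < m) y ord0 i ^+ 2).

Definition partial (k : 'I_n) u x : R := 'D_(delta_mx ord0 k) u x.

(* All iterated partial derivatives, of every order, exist and are continuous.
   Derivability is required separately because 'D is a total operator. *)
Definition smooth u : Prop := forall s : seq 'I_n,
  continuous (foldr partial u s) /\
  forall x (k : 'I_n), derivable (foldr partial u s) x (delta_mx ord0 k).

Definition compactly_supported u : Prop := compact (closure [set x | u x != 0]).

Definition gradient u x : 'rV[R]_n := \row_k partial k u x.

Definition laplacian u x : R := \sum_(k < n) partial k (partial k u) x.

(* |Phi_f'(x)|. Where f x = 0 the value is 0, since inversion is total with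
   0^-1 = 0. *)
Definition phase_derivative m (f : 'rV[R]_n -> 'rV[R]_m) x : R :=
  Num.sqrt (\sum_(k < n) \sum_(j < m) \sum_(l < m | (j < l)%N)
    (f x ord0 l / enorm (f x) ^+ 2 * partial k (fun y => f y ord0 j) x
     - f x ord0 j / enorm (f x) ^+ 2 * partial k (fun y => f y ord0 l) x) ^+ 2).

End calculus.

(* Main.v *)
From HB Require Import structures.
Require Import Defs.
From mathcomp Require Import all_boot all_order all_algebra.
From mathcomp Require Import all_classical all_reals all_analysis measurable_realfun.
From mathcomp Require Import ring.
Import Order.TTheory GRing.Theory Num.Theory.
Import numFieldNormedType.Exports.
Local Open Scope classical_set_scope.
Local Open Scope ring_scope.

(** Put f = grad u. The inequality is the sum of two applications of the
    Cauchy-Schwarz inequality that share the factor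
    W = int |f|^(2p-2) / |x|^(2q-2), and rests on two facts.

    First, int |Delta u|^2 is the integral of the squared Hessian: integrating
    by parts twice turns d_j d_j u * d_k d_k u into (d_k d_j u)^2
    (integral_laplacian_sqr). Where f does not vanish, the squared Hessian |Df|^2
    splits in polar coordinates as |grad |f||^2 + |f|^2 |Phi_f'|^2; this is the Lagrange
    identity (modulus_phase_split).

    Second, a weighted Hardy inequality (hardy):
      (n - q) int |f|^p / |x|^q <=
        p int |f|^(p-1) / |x|^(q-1) * |grad |f||.
    It comes from integrating the divergence of |f|^p |x|^(-q) x, since the
    divergence of |x|^(-q) x is (n - q) |x|^(-q). The singularity at the origin is
    removed by using (|x|^2 + e)^(-q/2) instead of |x|^(-q), at the price of an
    inequality in the right direction, and Fatou's lemma lets e tend to 0.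

    Then Cauchy-Schwarz bounds the square of the right integral in the Hardy
    inequality by W int |grad |f||^2, and the square of the phase integral by
    W int |f|^2 |Phi_f'|^2; adding the two gives W int |Delta u|^2.
    All the integrals of nonnegative functions are taken in the extended reals,
    so that W may be infinite.

    The basic tool is that a partial derivative of a C^1 function with compact
    support has integral zero (integral_partial), by Fubini's theorem and the
    fundamental theorem of calculus. The preliminaries to it are that continuous
    functions are measurable for the sigma-algebra generated by the coordinates
    and that the Lebesgue measure of R^n is sigma-finite. *)

Set Implicit Arguments.
Unset Strict Implicit.
Unset Printing Implicit Defensive.

(** * Borel sets of R^n *)

Section borel_rV.
Context {R : realType}.

Lemma ball_rVE n (c : 'rV[R]_n) (e : R) (e0 : 0 < e) :
  ball c e = \bigcap_(i in [set: 'I_n])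
    ((fun x : 'rV[R]_n => x ord0 i) @^-1` ball (c ord0 i) e).
Proof.
apply/seteqP; split => [x [_ h] i _|x h]; first exact: h.
by split => // i j; rewrite ord1; exact: h.
Qed.

(** The norm on row vectors is the sup norm, so a ball is a box, and boxes
    belong to the sigma-algebra generated by the coordinates. *)
Lemma measurable_ball_rV n (c : 'rV[R]_n) (e : R) :
  0 < e -> measurable (ball c e).
Proof.
move=> e0; rewrite ball_rVE//.
apply: fin_bigcap_measurable => // i _.
rewrite -[X in measurable X]setTI; apply: measurable_coord_rV => //.
apply: open_measurable; exact: ball_open.
Qed.

(** An open set is the union of the balls that it contains, with rational
    centre and radius the inverse of a positive integer; there are countably
    many of these. *)
Lemma open_measurable_rV n (U : set 'rV[R]_n) : open U -> measurable U.
Proof.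
move=> oU.
pose c (z : 'rV[rat]_n) : 'rV[R]_n := \row_i ratr (z ord0 i).
pose D := [set z : 'rV[rat]_n * nat | ball (c z.1) z.2.+1%:R^-1 `<=` U].
have -> : U = \bigcup_(z in D) ball (c z.1) z.2.+1%:R^-1.
  apply/seteqP; split => [x Ux|x [z Dz]]; last exact: Dz.
  have /nbhs_ballP[e /= e0 eU] := open_nbhs_nbhs (conj oU Ux).
  pose m := Num.truncn (2 / e).
  have me : m.+1%:R^-1 < e / 2 :> R.
    rewrite -invf_div ltf_pV2 ?posrE ?divr_gt0//.
    exact: truncnS_gt.
  have m0 : 0 < m.+1%:R^-1 :> R by rewrite invr_gt0.
  have H i : exists r : rat, ball (x ord0 i) m.+1%:R^-1 (ratr r : R).
    have lt : x ord0 i - m.+1%:R^-1 < x ord0 i + m.+1%:R^-1.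
      by rewrite ltrBlDr -addrA ltrDl addr_gt0.
    have [r] := rat_in_itvoo lt.
    by rewrite in_itv/= => /andP[? ?]; exists r; rewrite /ball/= ltr_distlC; apply/andP.
  have [r rP] := choice H.
  exists (\row_i r i, m) => /=.
    move=> y [_ xy]; apply: eU; split => // i j.
    rewrite ord1 [e]splitr.
    apply: (@ball_triangle _ _ (c (\row_i r i) ord0 j)).
      apply: (le_ball (ltW me)); rewrite !mxE; exact: rP.
    exact: (le_ball (ltW me)).
  split => // i j; rewrite ord1; apply: ball_sym; rewrite !mxE; exact: rP.
rewrite bigcup_mkcond; apply: countable_bigcupT_measurable => // z.
by case: ifPn => // _; exact: measurable_ball_rV.
Qed.

Lemma continuous_measurable_rV n (f : 'rV[R]_n -> R) :
  continuous f -> measurable_fun setT f.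
Proof.
move=> /continuousP cf.
apply: (measurability _ (RGenOpens.measurableE R)).
move=> _ [_ [a [b ->] <-]]; rewrite setTI.
by apply: open_measurable_rV; apply: cf; exact: interval_open.
Qed.

End borel_rV.

(** * Lebesgue measure of R^n and Fubini's theorem *)

Section leb.
Context {R : realType}.

(** The measure of the definitions under a name of its own, so that its
    sigma-finiteness can be attached to it as a canonical instance. *)
Definition leb n : set 'rV[R]_n -> \bar R := lebesgue_measure_rV n.
HB.instance Definition _ n := Measure.on (@leb n).

Definition box n (M : R) : set 'rV[R]_n := [set x | forall i, `|x ord0 i| <= M].
Arguments box : clear implicits.

Let boxE n M : box n M = [set x | forall i, `[- M, M]%classic (x ord0 i)].
Proof.
by apply/seteqP; split => x + i => /(_ i); rewrite /= in_itv/= ler_norml.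
Qed.

Lemma measurable_box n M : measurable (box n M).
Proof.
rewrite boxE [X in measurable X](_ : _ = \bigcap_(i in [set: 'I_n])
      ((fun x : 'rV[R]_n => x ord0 i) @^-1` `[- M, M]%classic)).
  apply: fin_bigcap_measurable => // i _.
  by rewrite -[X in measurable X]setTI; exact: measurable_coord_rV.
by apply/seteqP; split => x h i; [move=> _|]; exact: h.
Qed.

Lemma leb_box_lty n M : (leb (box n M) < +oo)%E.
Proof.
rewrite boxE /leb (lebesgue_measure_rV_box (A := fun=> `[- M, M]%classic))//.
rewrite (eq_bigr (fun=> (fine (lebesgue_measure `[- M, M]%classic))%:E)).
  by rewrite prodEFin ltry.
move=> i _; rewrite fineK//= lebesgue_measure_itv/=.
by case: ifPn => //.
Qed.

Lemma leb_sigma_finite n : sigma_finite setT (@leb n).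
Proof.
exists (fun k => box n k%:R).
  apply/esym; rewrite -subTset => x _.
  exists (Num.truncn (\sum_i `|x ord0 i|)).+1 => // i.
  apply: le_trans (ltW (truncnS_gt _)).
  by rewrite (bigD1 i)//= lerDl sumr_ge0.
by move=> k; split; [exact: measurable_box|exact: leb_box_lty].
Qed.

HB.instance Definition _ n := @Measure_isSigmaFinite.Build _ _ _ (@leb n) (@leb_sigma_finite n).

Lemma lebE n D (f : 'rV[R]_n -> \bar R) :
  (\int[lebesgue_measure_rV n]_(x in D) f x = \int[@leb n]_(x in D) f x)%E.
Proof. by []. Qed.

Lemma integrable_cons n (f : 'rV[R]_n.+1 -> \bar R) :
  (@leb n.+1).-integrable setT f ->
  (lebesgue_measure \x @leb n)%E.-integrable setT (f \o @cons_rV R n).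
Proof.
move=> /integrableP[mf fi]; apply/integrableP; split.
  by apply: measurableT_comp => //; exact: measurable_cons_rV.
move: fi; rewrite [X in (X < _)%E -> _](_ : _ =
  \int[pushforward (lebesgue_measure \x^ @leb n) (@cons_rV R n)]_x `|f x|)%E//.
rewrite ge0_integral_pushforward//; first last.
- exact: measurableT_comp.
- exact: measurable_cons_rV.
rewrite preimage_setT => fi; apply: le_lt_trans fi.
rewrite le_eqVlt; apply/orP; left; apply/eqP/eq_measure_integral => //= A mA _.
by apply: product_measure_unique => // B C mB mC/=; rewrite product_measure2E.
Qed.

(** The measure on R^(n+1) is the image of the product with the sections taken
    in one order, whereas Fubini's theorem speaks of the other order; by
    sigma-finiteness the two products agree. *)
Lemma integral_cons n (f : 'rV[R]_n.+1 -> \bar R) :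
  (@leb n.+1).-integrable setT f ->
  (\int[@leb n.+1]_x f x = \int[lebesgue_measure \x @leb n]_z f (cons_rV z))%E.
Proof.
move=> fi; have /integrableP[mf _] := fi; have ci := integrable_cons fi.
rewrite [LHS](_ : _ =
  \int[pushforward (lebesgue_measure \x^ @leb n) (@cons_rV R n)]_x f x)%E//.
have e A : measurable A -> A `<=` [set: measurableTypeR R * 'rV[R]_n] ->
    (lebesgue_measure \x @leb n)%E A = (lebesgue_measure \x^ @leb n)%E A.
  move=> mA _.
  by apply: product_measure_unique => // B C mB mC/=; rewrite product_measure2E.
rewrite integral_pushforward//.
- by apply/esym/eq_measure_integral.
- exact: measurable_cons_rV.
- rewrite preimage_setT; apply/integrableP; split.
    by apply: measurableT_comp => //; exact: measurable_cons_rV.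
  move/integrableP : ci => [_]; apply: le_lt_trans.
  by rewrite le_eqVlt; apply/orP; left; apply/eqP/esym/eq_measure_integral.
Qed.

Lemma integral_cons1 n (f : 'rV[R]_n.+1 -> \bar R) :
  (@leb n.+1).-integrable setT f ->
  (\int[@leb n.+1]_x f x =
   \int[lebesgue_measure]_t \int[@leb n]_y f (cons_rV (t, y)))%E.
Proof.
move=> fi; rewrite integral_cons//.
by rewrite -(integral12_prod_meas1 (integrable_cons fi)).
Qed.

Lemma integral_cons2 n (f : 'rV[R]_n.+1 -> \bar R) :
  (@leb n.+1).-integrable setT f ->
  (\int[@leb n.+1]_x f x =
   \int[@leb n]_y \int[lebesgue_measure]_t f (cons_rV (t, y)))%E.
Proof.
move=> fi; rewrite integral_cons//.
by rewrite -(integral21_prod_meas1 (integrable_cons fi)).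
Qed.

End leb.
Arguments box {R} n M.
Arguments leb {R} n.

(** * The integral of a partial derivative *)

(** A directional derivative depends only on the values along a line, so a
    map that is affine along that line transports it. This turns a partial
    derivative into a derivative on a slice, or on a translate. *)
Lemma derive_affine (R : numFieldType) (V W Y : normedModType R) (f : V -> Y) (phi : W -> V)
    (w : W) (v : V) (x : W) :
  (forall h : R, phi (h *: w + x) = h *: v + phi x) ->
  (derivable (f \o phi) x w <-> derivable f (phi x) v) /\
  'D_w (f \o phi) x = 'D_v f (phi x).
Proof.
move=> hphi.
have e : (fun h : R => h^-1 *: ((f \o phi) (h *: w + x) - (f \o phi) x)) =
         (fun h : R => h^-1 *: (f (h *: v + phi x) - f (phi x))).
  by apply/funext => h; rewrite /= hphi.
by split; rewrite /derivable /derive /= e.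
Qed.

Section integral_partial.
Context {R : realType}.

Lemma continuous_rV (T : topologicalType) n (f : T -> 'rV[R]_n) :
  (forall i, continuous (fun t => f t ord0 i)) -> continuous f.
Proof.
move=> cf t; apply/cvgrPdist_lt => e e0.
have : \forall s \near t, forall i, `|f t ord0 i - f s ord0 i| < e.
  by apply: filter_forall => i; move/cvgrPdist_lt : (cf i t); exact.
apply: filterS => s h.
rewrite -[ltLHS]/(mx_norm _) mx_normrE; apply/bigmax_ltP; split => // -[i j] _ /=.
by rewrite ord1 !mxE.
Qed.

Lemma compact_box n M : compact (box n M : set 'rV[R]_n).
Proof.
have := @rV_compact R n (fun=> `[- M, M]%classic) (fun=> @segment_compact _ _ _).
congr compact; apply/seteqP.
by split => x + i => /(_ i); rewrite /= in_itv/= ler_norml.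
Qed.

Lemma outside_box_near n M (x : 'rV[R]_n) :
  ~ box n M x -> \forall y \near x, ~ box n M y.
Proof.
move=> /existsNP[i /negP]; rewrite -ltNge => Mx.
have : \forall y \near x, M < `|(y : 'rV[R]_n) ord0 i|.
  exact: (@cvgr_norm_gt R R^o _ (nbhs x) _ (fun y : 'rV[R]_n => y ord0 i : R^o) _
    (@coord_continuous R 1 n ord0 i x) M Mx).
by apply: filterS => y My /(_ i); rewrite leNgt My.
Qed.

Definition vanishes_outside n M (h : 'rV[R]_n -> R) := forall x, ~ box n M x -> h x = 0.

Lemma partial_vanishes_outside n M (h : 'rV[R]_n -> R) k :
  vanishes_outside M h -> vanishes_outside M (partial k h).
Proof.
move=> hM x Mx; rewrite /partial (@near_eq_derive _ _ _ _ (cst 0)) ?derive_cst//.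
by apply: filterS (outside_box_near Mx) => y /hM.
Qed.

Lemma integrable_continuous n M (h : 'rV[R]_n -> R) :
  continuous h -> vanishes_outside M h -> (leb n).-integrable setT (EFin \o h).
Proof.
move=> ch hM.
have -> : EFin \o h = (EFin \o h) \_ (box n M).
  apply/funext => x; rewrite patchE; case: ifPn => // /negP xM /=.
  by rewrite hM// => ?; apply: xM; rewrite inE.
have mb := @measurable_box R n M.
apply/(integrable_mkcond (EFin \o h) mb).
apply: (@measurable_bounded_integrable _ _ _ (leb n) h _ mb).
- exact: leb_box_lty.
- by apply/measurable_funTS; exact: continuous_measurable_rV.
- have cK : compact (h @` box n M).
    apply: continuous_compact; last exact: compact_box.
    exact: continuous_subspaceT.
  have [B [_ mrt]] := compact_bounded cK.
  by exists B; split; rewrite ?num_real// => ? ? ? ?; exact: mrt.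
Qed.

(** By the fundamental theorem of calculus on a segment that contains the
    support in its interior. *)
Lemma integral_derive_real (M : R) (g g' : R -> R) :
  (forall t : R, is_derive t 1 g (g' t)) -> continuous g' ->
  (forall t : R, M < `|t| -> g t = 0) ->
  (\int[lebesgue_measure]_t (g' t)%:E = 0)%E.
Proof.
move=> dg cg' gM.
pose N : R := `|M| + 1.
have MN : M < N by rewrite /N (le_lt_trans (ler_norm _))// ltrDl.
have N0 : 0 < N by rewrite /N ltr_wpDl.
have g'0 t : M < `|t| -> g' t = 0.
  move=> Mt; have -> : g' t = 'D_1 g t by apply/esym/derive_val.
  rewrite (@near_eq_derive _ _ _ _ (cst 0)) ?derive_cst//.
  have : \forall s \near t, M < `|s|.
    exact: (@cvgr_norm_gt R R^o _ (nbhs t) _ id t cvg_id M Mt).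
  by apply: filterS => s /gM.
have -> : (\int[lebesgue_measure]_t (g' t)%:E =
           \int[lebesgue_measure]_(t in `[(- N)%R, N]) (g' t)%:E)%E.
  rewrite [RHS]integral_mkcond; apply: eq_integral => t _.
  rewrite patchE; case: ifPn => // /negP tN /=; rewrite g'0//.
  apply: (lt_trans MN); rewrite ltNge; apply/negP => tN'; apply: tN.
  by rewrite inE/= in_itv/= -ler_norml.
have cg : continuous g.
  by move=> t; apply: differentiable_continuous; apply/derivable1_diffP; exact: ex_derive.
rewrite (@continuous_FTC2 _ g' g)//.
- have gN : g N = 0 by apply: gM; rewrite gtr0_norm.
  have gNN : g (- N) = 0 by apply: gM; rewrite normrN gtr0_norm.
  by rewrite gN gNN subee.
- by rewrite ltrNl (lt_trans _ N0)// oppr_lt0.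
- exact: continuous_subspaceT.
- split.
  + by move=> x _; exact: ex_derive.
  + by apply: cvg_at_right_filter; exact: cg.
  + by apply: cvg_at_left_filter; exact: cg.
- by move=> x _; rewrite derive1E; exact: derive_val.
Qed.

Lemma cons_rV0 n (t : R) (y : 'rV[R]_n) : cons_rV (t, y) ord0 ord0 = t.
Proof. by rewrite mxE unlift_none. Qed.

Lemma cons_rVS n (t : R) (y : 'rV[R]_n) i : cons_rV (t, y) ord0 (lift ord0 i) = y ord0 i.
Proof. by rewrite mxE liftK. Qed.

(** By induction on the dimension. If k is the first coordinate, integrate over
    it first, on slices, where the fundamental theorem of calculus applies;
    otherwise freeze the first coordinate and use the statement one dimension
    lower. *)
Lemma integral_partial n M k (g : 'rV[R]_n -> R) :
  (forall x, derivable g x (delta_mx ord0 k)) -> continuous (partial k g) ->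
  vanishes_outside M g ->
  (\int[leb n]_x (partial k g x)%:E = 0)%E.
Proof.
elim: n k g => [[]//|n ih] k g dg cg gM.
have ig : (leb n.+1).-integrable setT (EFin \o partial k g).
  exact: (integrable_continuous cg (partial_vanishes_outside k gM)).
case: (unliftP ord0 k) => [j kj|k0].
- rewrite (integral_cons1 ig) integral0_eq// => t _.
  pose phi (y : 'rV[R]_n) : 'rV[R]_n.+1 := cons_rV (t, y).
  have phiE y h : phi (h *: delta_mx ord0 j + y) = h *: delta_mx ord0 k + phi y.
    apply/rowP => i; rewrite kj; case: (unliftP ord0 i) => [i'|] ->.
      by rewrite cons_rVS !mxE liftK/= (inj_eq lift_inj).
    by rewrite cons_rV0 !mxE unlift_none/= mulr0 add0r.
  have e y : partial k g (phi y) = partial j (g \o phi) y.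
    by rewrite /partial (derive_affine g (phiE y)).2.
  have cphi : continuous phi.
    apply: continuous_rV => i; case: (unliftP ord0 i) => [i'|] ->.
      rewrite (_ : (fun _ => _) = (fun y : 'rV[R]_n => y ord0 i')).
        exact: coord_continuous.
      by apply/funext => y; rewrite cons_rVS.
    rewrite (_ : (fun _ => _) = cst t); first exact: cst_continuous.
    by apply/funext => y; rewrite cons_rV0.
  rewrite /= -[RHS](ih j (g \o phi)).
  + by apply: eq_integral => y _; rewrite e.
  + by move=> y; apply/(derive_affine g (phiE y)).1.
  + rewrite (_ : partial j _ = partial k g \o phi); last by apply/funext => y; rewrite /= e.
    by move=> y; apply: continuous_comp; [exact: cphi|exact: cg].
  + move=> y yM; apply: gM => h; apply: yM => i.
    by have := h (lift ord0 i); rewrite cons_rVS.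
- rewrite (integral_cons2 ig) integral0_eq// => y _.
  pose phi (t : R) : 'rV[R]_n.+1 := cons_rV (t, y).
  have phiE t h : phi (h *: (1 : R) + t) = h *: delta_mx ord0 k + phi t.
    apply/rowP => i; rewrite k0; case: (unliftP ord0 i) => [i'|] ->.
      by rewrite cons_rVS !mxE liftK/= mulr0 add0r.
    by rewrite cons_rV0 !mxE unlift_none.
  have cphi : continuous phi.
    apply: continuous_rV => i; case: (unliftP ord0 i) => [i'|] ->.
      rewrite (_ : (fun _ => _) = cst (y ord0 i')); first exact: cst_continuous.
      by apply/funext => t; rewrite cons_rVS.
    rewrite (_ : (fun _ => _) = id); first by move=> ?; exact: cvg_id.
    by apply/funext => s; rewrite cons_rV0.
  apply: (@integral_derive_real M (g \o phi) (partial k g \o phi)).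
  + move=> t; apply: DeriveDef; first exact/(derive_affine g (phiE t)).1.
    by rewrite (derive_affine g (phiE t)).2.
  + by move=> t; apply: continuous_comp; [exact: cphi|exact: cg].
  + move=> t Mt; apply: gM => /(_ ord0); rewrite cons_rV0 leNgt.
    by rewrite Mt.
Qed.

End integral_partial.

(** * Symmetry of second derivatives *)

Section schwarz.
Context {R : realType} {V : normedModType R}.
Implicit Types (u g : V -> R) (v w x : V).

Lemma derive_MVT g v x (h : R) : 0 < h ->
  (forall y, derivable g y v) ->
  exists2 c, 0 < c < h & g (h *: v + x) - g x = h * 'D_v g (c *: v + x).
Proof.
move=> h0 dg.
pose phi (t : R) : V := t *: v + x.
have phiE (t s : R) : phi (s *: (1 : R) + t) = s *: v + phi t.
  by rewrite /phi scalerDl addrA /GRing.scale/= mulr1.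
have d (t : R) : is_derive t 1 (g \o phi) ('D_v g (phi t)).
  apply: DeriveDef; first exact/(derive_affine g (phiE t)).1.
  by rewrite (derive_affine g (phiE t)).2.
have [|c + e] := MVT h0 (fun t _ => d t).
  apply: continuous_subspaceT => t; apply: differentiable_continuous.
  by apply/derivable1_diffP; exact: ex_derive.
rewrite in_itv/= => c0h; exists c => //.
by move: e; rewrite /phi/= scale0r add0r subr0 mulrC.
Qed.

Lemma derive_shift_vec g v x z :
  (derivable (fun y => g (z + y)) x v <-> derivable g (z + x) v) /\
  'D_v (fun y => g (z + y)) x = 'D_v g (z + x).
Proof. by apply: (@derive_affine _ _ _ _ g (fun y => z + y)) => h; rewrite addrCA. Qed.

(** The mean value theorem, first in the direction v for the increment of u
    along w, then in the direction w for the derivative of u along v. *)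
Lemma second_difference u v w x (h : R) : 0 < h ->
  (forall y, derivable u y v) -> (forall y, derivable ('D_v u) y w) ->
  exists c d, [/\ 0 < c < h, 0 < d < h &
    u (h *: w + (h *: v + x)) - u (h *: v + x) - (u (h *: w + x) - u x) =
    h * (h * 'D_w ('D_v u) (d *: w + (c *: v + x)))].
Proof.
move=> h0 dv dw.
pose F y := u (h *: w + y) - u y.
have dF y : is_derive y v F ('D_v u (h *: w + y) - 'D_v u y).
  apply: is_deriveB.
    apply: DeriveDef; first exact/(derive_shift_vec _ _ _ _).1.
    exact: (derive_shift_vec _ _ _ _).2.
  exact: derivableP.
have [|c ch Fc] := derive_MVT x h0 (g := F) (v := v); first by move=> y; exact: ex_derive.
have [d dh Dd] := derive_MVT (c *: v + x) h0 dw.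
exists c, d; split => //.
rewrite -Dd -[LHS]/(F (h *: v + x) - F x) Fc; congr (_ * _).
exact: derive_val.
Qed.

(** The second difference of u at x is symmetric in v and w. By
    second_difference the two mixed derivatives therefore coincide at some two points
    arbitrarily close to x, and continuity does the rest. *)
Lemma derive_comm u v w x :
  (forall y, derivable u y v) -> (forall y, derivable u y w) ->
  (forall y, derivable ('D_v u) y w) -> (forall y, derivable ('D_w u) y v) ->
  {for x, continuous ('D_w ('D_v u))} -> {for x, continuous ('D_v ('D_w u))} ->
  'D_w ('D_v u) x = 'D_v ('D_w u) x.
Proof.
move=> dv dw dvw dwv cvw cwv.
set A := 'D_w ('D_v u) in cvw *; set B := 'D_v ('D_w u) in cwv *.
apply/eqP; rewrite -subr_eq0 -normr_le0; apply/ler_addgt0Pr => e e0; rewrite add0r.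
have e20 : 0 < e / 2 by rewrite divr_gt0.
move/cvgrPdist_lt : cvw => /(_ _ e20) /nbhs_ballP[a /= a0 aA].
move/cvgrPdist_lt : cwv => /(_ _ e20) /nbhs_ballP[b /= b0 bB].
pose m := Num.min a b; have m0 : 0 < m by rewrite lt_min a0.
pose h := m / (`|v| + `|w| + 1).
have vw0 : 0 < `|v| + `|w| + 1 by rewrite ltr_wpDl// addr_ge0.
have h0 : 0 < h by rewrite divr_gt0.
have small c d : 0 < c < h -> 0 < d < h -> `|c *: v + d *: w| < m.
  move=> /andP[c0 ch] /andP[d0 dh].
  rewrite (le_lt_trans (ler_normD _ _))// !normrZ !gtr0_norm//.
  rewrite (@le_lt_trans _ _ (h * (`|v| + `|w|)))//.
    by rewrite mulrDr lerD// ler_wpM2r// ltW.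
  by rewrite /h mulrAC ltr_pdivrMr// ltr_pM2l// ltrDl.
have [c [d [ch dh E1]]] := second_difference x h0 dv dvw.
have [c' [d' [ch' dh' E2]]] := second_difference x h0 dw dwv.
have E : A (d *: w + (c *: v + x)) = B (d' *: v + (c' *: w + x)).
  have hh : h * h != 0 by rewrite mulf_neq0// gt_eqF.
  apply: (mulfI hh); rewrite -[LHS]mulrA -[RHS]mulrA.
  refine (etrans (esym E1) (etrans _ E2)); rewrite [h *: v + (h *: w + x)]addrCA.
  ring.
have hA : `|A x - A (d *: w + (c *: v + x))| < e / 2.
  apply: aA; rewrite -ball_normE/= addrA opprD addrCA subrr addr0 normrN addrC.
  apply: lt_le_trans (small _ _ ch dh) _; by rewrite ge_min lexx.
have hB : `|B x - B (d' *: v + (c' *: w + x))| < e / 2.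
  apply: bB; rewrite -ball_normE/= addrA opprD addrCA subrr addr0 normrN.
  apply: lt_le_trans (small _ _ dh' ch') _; by rewrite ge_min lexx orbT.
rewrite -E distrC in hB.
rewrite [e]splitr -(subrKA (A (d *: w + (c *: v + x)))).
exact: le_trans (ler_normD _ _) (lerD (ltW hA) (ltW hB)).
Qed.

End schwarz.

(** * Functions of integral zero *)

Section continuity.
Context {R : realType} {T : topologicalType}.
Implicit Types f g : T -> R.

Lemma continuous_add f g :
  continuous f -> continuous g -> continuous (fun x => f x + g x).
Proof. by move=> cf cg x; exact: (continuousD (cf x) (cg x)). Qed.

Lemma continuous_mul f g :
  continuous f -> continuous g -> continuous (fun x => f x * g x).
Proof. by move=> cf cg x; exact: (continuousM (cf x) (cg x)). Qed.

Lemma continuous_sum (I : Type) (s : seq I) (F : I -> T -> R) :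
  (forall i, continuous (F i)) -> continuous (fun x => \sum_(i <- s) F i x).
Proof.
move=> cF; elim: s => [|i s ih].
  rewrite (_ : (fun _ => _) = cst 0); first by move=> x; exact: cst_continuous.
  by apply/funext => y; rewrite big_nil.
rewrite (_ : (fun _ => _) = fun y => F i y + \sum_(j <- s) F j y).
  exact: continuous_add.
by apply/funext => y; rewrite big_cons.
Qed.

End continuity.

Section null_integral.
Context {R : realType} {n : nat}.
Implicit Types f g h : 'rV[R]_n -> R.

(** Identities that hold up to a divergence are expressed below by saying that
    the difference of the two integrands satisfies this predicate, which is
    stable under sums. *)
Definition null_integral f :=
  (leb n).-integrable setT (EFin \o f) /\ (\int[leb n]_x (f x)%:E = 0)%E.

Lemma null_integralD f g :
  null_integral f -> null_integral g -> null_integral (fun x => f x + g x).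
Proof.
move=> [fi f0] [gi g0]; split.
  rewrite (_ : _ \o _ = (EFin \o f) \+ (EFin \o g))%E//.
  exact: integrableD.
by under eq_integral do rewrite EFinD; rewrite integralD// f0 g0 adde0.
Qed.

Lemma null_integralN f : null_integral f -> null_integral (fun x => - f x).
Proof.
move=> [fi f0]; split.
  rewrite (_ : _ \o _ = \- (EFin \o f))%E//.
  exact: integrableN.
by rewrite -[RHS]oppe0 -f0 -integralN// integrable_add_def.
Qed.

Lemma null_integral_sum (I : finType) (F : I -> 'rV[R]_n -> R) :
  (forall i, null_integral (F i)) -> null_integral (fun x => \sum_i F i x).
Proof.
move=> h; elim: (index_enum I) => [|i s ih].
  rewrite (_ : (fun _ => _) = cst 0); last by apply/funext => x; rewrite big_nil.
  split; last by rewrite integral0_eq.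
  exact: (@integrable0 _ _ _ (leb n) setT).
rewrite (_ : (fun _ => _) = fun x => F i x + \sum_(j <- s) F j x).
  exact: null_integralD.
by apply/funext => x; rewrite big_cons.
Qed.

Lemma integral_add_null f g : (leb n).-integrable setT (EFin \o f) -> null_integral g ->
  (\int[leb n]_x (f x + g x)%:E = \int[leb n]_x (f x)%:E)%E.
Proof.
move=> fi [gi g0].
by under eq_integral do rewrite EFinD; rewrite integralD// g0 adde0.
Qed.

Lemma null_integral_partial M k g :
  (forall x, derivable g x (delta_mx ord0 k)) -> continuous (partial k g) ->
  vanishes_outside M g -> null_integral (partial k g).
Proof.
move=> dg cg gM; split; last exact: integral_partial gM.
by apply: integrable_continuous (partial_vanishes_outside k gM).
Qed.

Lemma null_integral_partialM M k f g :
  (forall x, derivable f x (delta_mx ord0 k)) -> (forall x, derivable g x (delta_mx ord0 k)) ->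
  continuous f -> continuous g ->
  continuous (partial k f) -> continuous (partial k g) ->
  vanishes_outside M f -> null_integral (fun x => partial k f x * g x + f x * partial k g x).
Proof.
move=> df dg cf cg cdf cdg fM.
have e : partial k (f * g) = fun x => partial k f x * g x + f x * partial k g x.
  apply/funext => x; rewrite /partial deriveM// addrC; congr (_ + _).
  by rewrite /GRing.scale/= mulrC.
rewrite -e; apply: (@null_integral_partial M).
- by move=> x; exact: derivableM.
- by rewrite e; apply: continuous_add; exact: continuous_mul.
- by move=> x /fM fx; rewrite /GRing.mul/= fx mul0r.
Qed.

End null_integral.

(** * The Laplacian and the Hessian in L^2 *)

Section hessian.
Context {R : realType} {n : nat}.
Implicit Types (u : 'rV[R]_n -> R).

Lemma smooth_partial u k : smooth u -> smooth (partial k u).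
Proof. by move=> su s; have := su (rcons s k); rewrite foldr_rcons. Qed.

Lemma smooth_continuous u : smooth u -> continuous u.
Proof. by move=> /(_ [::])[]. Qed.

Lemma smooth_derivable u x k : smooth u -> derivable u x (delta_mx ord0 k).
Proof. by move=> /(_ [::])[_]; exact. Qed.

Lemma partialC u j k : smooth u -> partial j (partial k u) = partial k (partial j u).
Proof.
move=> su; apply/funext => x; apply: derive_comm.
- by move=> y; exact: smooth_derivable.
- by move=> y; exact: smooth_derivable.
- by move=> y; apply: smooth_derivable; exact: smooth_partial.
- by move=> y; apply: smooth_derivable; exact: smooth_partial.
- by apply: smooth_continuous; do 2 apply: smooth_partial.
- by apply: smooth_continuous; do 2 apply: smooth_partial.
Qed.

Lemma compactly_supported_vanishes u :
  compactly_supported u -> exists M, vanishes_outside M u.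
Proof.
move=> /compact_bounded[M [_ Mu]]; exists (M + 1) => x xM.
apply/eqP; apply: contrapT => /negP ux0; apply: xM => i.
have M1 : M < M + 1 by rewrite ltrDl.
have /= xM := Mu _ M1 x (@subset_closure _ [set x | u x != 0] x ux0).
apply: le_trans xM; rewrite -[leRHS]/(mx_norm x) mx_normrE.
by apply/bigmax_geP; right => /=; exists (ord0, i).
Qed.

(** The function is d_j (d_j u * d_k d_k u) - d_k (d_j u * d_k d_j u): the
    terms with three derivatives cancel because partial derivatives commute. *)
Lemma null_integral_hessian M u j k : smooth u -> vanishes_outside M u ->
  null_integral (fun x => partial j (partial j u) x * partial k (partial k u) x
                          - partial k (partial j u) x ^+ 2).
Proof.
move=> su uM.
have s1 i := smooth_partial i su.
have s2 i i' := smooth_partial i' (s1 i).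
have s3 i i' i'' := smooth_partial i'' (s2 i i').
have c1 i := smooth_continuous (s1 i).
have c2 i i' := smooth_continuous (s2 i i').
have c3 i i' i'' := smooth_continuous (s3 i i' i'').
have d1 i l x := @smooth_derivable _ x l (s1 i).
have d2 i i' l x := @smooth_derivable _ x l (s2 i i').
have vM := partial_vanishes_outside j uM.
have N1 := null_integral_partialM (d1 j j) (d2 k k j) (c1 j) (c2 k k) (c2 j j) (c3 k k j) vM.
have N2 := null_integral_partialM (d1 j k) (d2 j k k) (c1 j) (c2 j k) (c2 j k) (c3 j k k) vM.
have := null_integralD N1 (null_integralN N2).
congr null_integral; apply/funext => x.
have alg (a b c d e : R) : a * b + c * d - (e * e + c * d) = a * b - e ^+ 2 by ring.
rewrite (_ : partial k (partial k (partial j u)) = partial j (partial k (partial k u))).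
  exact: alg.
by rewrite (partialC k j su) (partialC k j (s1 k)).
Qed.

(** Expanding the square of the Laplacian gives the sum over j and k of
    d_j d_j u * d_k d_k u, and each of these products can be exchanged for
    (d_k d_j u)^2 under the integral. *)
Theorem integral_laplacian_sqr u : smooth u -> compactly_supported u ->
  (\int[leb n]_x (`|laplacian u x| ^+ 2)%:E =
   \int[leb n]_x (\sum_j \sum_k partial k (partial j u) x ^+ 2)%:E)%E.
Proof.
move=> su /compactly_supported_vanishes[M uM].
pose H x := \sum_(j < n) \sum_(k < n) partial k (partial j u) x ^+ 2.
have cH : continuous H.
  apply: continuous_sum => j; apply: continuous_sum => k.
  by apply: continuous_mul; apply: smooth_continuous; do 2 apply: smooth_partial.
have HM : vanishes_outside M H.
  move=> x xM; rewrite /H big1// => j _; rewrite big1// => k _.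
  by rewrite (partial_vanishes_outside k (partial_vanishes_outside j uM)) ?expr0n.
have iH := integrable_continuous cH HM.
have N := null_integral_sum (fun j => null_integral_sum (fun k => null_integral_hessian j k su uM)).
rewrite -[RHS](integral_add_null iH N); apply: eq_integral => x _; congr (_%:E).
rewrite real_normK ?num_real// /laplacian /H -big_split/= expr2 mulr_suml.
apply: eq_bigr => j _; rewrite mulr_sumr -big_split/=; apply: eq_bigr => k _.
by rewrite addrC subrK.
Qed.

End hessian.

(** * Powers and the chain rule *)

Section powers.
Context {R : realType}.

Lemma continuous_norm_powR (r : R) : 0 < r -> continuous (fun s : R => `|s| `^ r).
Proof.
move=> r0 s; have [->|s0] := eqVneq s 0.
  apply/cvgrPdist_lt => e e0; rewrite normr0 powR0 ?gt_eqF//.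
  near=> t; rewrite sub0r normrN ger0_norm ?powR_ge0//.
  rewrite (_ : e = (e `^ r^-1) `^ r); last by rewrite -powRrM mulVf ?gt_eqF// powRr1// ltW.
  rewrite gt0_ltr_powR ?nnegrE ?powR_ge0//.
  near: t; have e1 : 0 < e `^ r^-1 by rewrite powR_gt0.
  exact: (@cvgr0_norm_lt R R^o _ (nbhs (0 : R)) _ id cvg_id _ e1).
have ns0 : 0 < `|s| by rewrite normr_gt0.
apply: (@continuous_comp _ _ _ (fun s : R => `|s|) (@powR R ^~ r)); first exact: norm_continuous.
apply: differentiable_continuous; apply/derivable1_diffP.
by apply: ex_derive; exact: is_derive1_powR.
Unshelve. all: by end_near. Qed.

(** The odd extension of s `^ a. On negative numbers s `^ a is 1, so that s `^ a
    is not even continuous at 0, whereas the odd extension is C^1 for 1 < a;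
    this is what the chain rule needs at the zeros of a vector field. *)
Definition odd_powR (a s : R) : R := s * `|s| `^ (a - 1).

Lemma odd_powRE (a s : R) : 0 < a -> 0 <= s -> odd_powR a s = s `^ a.
Proof. by move=> a0 s0; rewrite /odd_powR ger0_norm// mulr_powRB1. Qed.

Lemma is_derive_odd_powR (a s : R) : 1 < a -> 0 <= s ->
  is_derive s 1 (odd_powR a) (a * `|s| `^ (a - 1)).
Proof.
move=> a1 s0; have a0 : 0 < a by rewrite (lt_trans _ a1).
have [->|sn0] := eqVneq s 0.
  (* at 0 the difference quotient is the power of order a - 1 > 0 of |h| *)
  have e : (fun h : R => h^-1 *: (odd_powR a (h *: (1 : R) + 0) - odd_powR a 0)) @ 0^' --> (0 : R).
    have a10 : 0 < a - 1 by rewrite subr_gt0.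
    have /continuous_withinNx c' := continuous_norm_powR a10 (x := 0).
    rewrite normr0 powR0 ?gt_eqF// in c'.
    apply: cvg_trans c'.
    apply: near_eq_cvg; near=> h.
    have h0 : h != 0 by near: h; exact: nbhs_dnbhs_neq.
    rewrite /odd_powR mul0r subr0 addr0 /GRing.scale/= mulr1 mulrA mulVf// mul1r//.
  rewrite normr0 powR0 ?subr_eq0 ?gt_eqF// mulr0.
  apply: DeriveDef; first by apply/cvg_ex; exists 0.
  exact: cvg_lim.
have {}s0 : 0 < s by rewrite lt_neqAle eq_sym sn0.
rewrite gtr0_norm//.
apply: (near_eq_is_derive (f := @powR R ^~ a)); last exact: is_derive1_powR.
near=> t; rewrite odd_powRE//.
near: t.
exact: (@cvgr_ge R _ (nbhs s) _ id s cvg_id _ s0).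
Unshelve. all: by end_near. Qed.

End powers.

Section chain.
Context {R : realType} {V : normedModType R}.

(** Reduced to one variable by restricting g to the line through x directed
    by v. *)
Lemma is_derive_comp_real (g : V -> R) (F : R -> R) x v dg dF :
  is_derive x v g dg -> is_derive (g x) 1 F dF -> is_derive x v (F \o g) (dF * dg).
Proof.
move=> hg hF.
pose phi (t : R) : V := t *: v + x.
have phi0 : phi 0 = x by rewrite /phi scale0r add0r.
have phiE (s : R) : phi (s *: (1 : R) + 0) = s *: v + phi 0.
  by rewrite phi0 addr0 /phi /GRing.scale/= mulr1.
have hgp : is_derive (0 : R) 1 (g \o phi) dg.
  apply: DeriveDef.
    by apply/(derive_affine g phiE).1; rewrite phi0; exact: ex_derive.
  by rewrite (derive_affine g phiE).2 phi0 derive_val.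
have hFp : is_derive ((g \o phi) 0) 1 F dF by rewrite /= phi0.
have h : is_derive (0 : R) 1 ((F \o g) \o phi) (dF * dg) := is_derive1_comp hFp hgp.
have [h1 h2] := derive_affine (F \o g) phiE; rewrite phi0 in h1 h2.
apply: DeriveDef; last by rewrite -h2; exact: (@derive_val _ _ _ _ _ _ _ h).
by apply/h1; exact: (@ex_derive _ _ _ _ _ _ _ h).
Qed.

Lemma is_derive_bigsum (I : Type) (s : seq I) (F : I -> V -> R) (dF : I -> R) x v :
  (forall i, is_derive x v (F i) (dF i)) ->
  is_derive x v (fun y => \sum_(i <- s) F i y) (\sum_(i <- s) dF i).
Proof.
move=> h; elim: s => [|i s ih].
  rewrite big_nil (_ : (fun _ => _) = cst 0); last by apply/funext => y; rewrite big_nil.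
  exact: is_derive_cst.
rewrite big_cons (_ : (fun _ => _) = F i + (fun y => \sum_(j <- s) F j y)).
  exact: is_deriveD.
by apply/funext => y; rewrite big_cons.
Qed.

Lemma is_derive_sqr (f : V -> R) x v df :
  is_derive x v f df -> is_derive x v (fun y => f y ^+ 2) (2 * (f x * df)).
Proof.
move=> h; have := is_deriveM h h.
congr (is_derive _ _ _ _).
rewrite /GRing.scale/=; ring.
Qed.

End chain.

Lemma is_derive_coord {R : realType} n (i k : 'I_n) (x : 'rV[R]_n) :
  is_derive x (delta_mx ord0 k) (fun y : 'rV[R]_n => y ord0 i) (i == k)%:R.
Proof.
pose phi (y : 'rV[R]_n) : R := y ord0 i.
have phiE (h : R) : phi (h *: delta_mx ord0 k + x) = h *: ((i == k)%:R : R) + phi x.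
  by rewrite /phi !mxE.
apply: DeriveDef.
  by apply/(derive_affine (id : R -> R) phiE).1; exact: derivable_id.
by rewrite (derive_affine (id : R -> R) phiE).2 derive_id.
Qed.

(** * The Euclidean norm of a vector field *)

Section enorm_facts.
Context {R : realType}.

Lemma sqr_enorm n (x : 'rV[R]_n) : enorm x ^+ 2 = \sum_(i < n) x ord0 i ^+ 2.
Proof. by rewrite sqr_sqrtr// sumr_ge0// => i _; exact: sqr_ge0. Qed.

Lemma enorm_ge0 n (x : 'rV[R]_n) : 0 <= enorm x.
Proof. exact: sqrtr_ge0. Qed.

Lemma enorm_powR n (x : 'rV[R]_n) (r : R) : enorm x `^ r = (enorm x ^+ 2) `^ (r / 2).
Proof.
by rewrite -powR_mulrn ?enorm_ge0// -powRrM mulrCA mulfV ?mulr1.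
Qed.

(** From the nonnegativity of the sum of the squares (A b_i - C a_i)^2, with A
    the sum of the a_i^2 and C the sum of the a_i b_i. *)
Lemma cauchy_schwarz_sum n (a b : 'I_n -> R) :
  `|\sum_i a i * b i| <= Num.sqrt (\sum_i a i ^+ 2) * Num.sqrt (\sum_i b i ^+ 2).
Proof.
have a0 : 0 <= \sum_i a i ^+ 2 by apply: sumr_ge0 => i _; exact: sqr_ge0.
have b0 : 0 <= \sum_i b i ^+ 2 by apply: sumr_ge0 => i _; exact: sqr_ge0.
rewrite -sqrtrM// -sqrtr_sqr ler_wsqrtr//.
set A := \sum_i a i ^+ 2; set B := \sum_i b i ^+ 2; set C := \sum_i a i * b i.
have [A0|An0] := eqVneq A 0.
  have az i : a i = 0.
    apply/eqP; rewrite -sqrf_eq0; move/eqP: A0; rewrite psumr_eq0 => [/allP|]; last first.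
      by move=> j _; exact: sqr_ge0.
    by move=> /(_ i); rewrite mem_index_enum => /(_ isT).
  by rewrite A0 mul0r /C big1 ?expr0n// => i _; rewrite az mul0r.
have : 0 <= \sum_i (A * b i - C * a i) ^+ 2 by apply: sumr_ge0 => i _; exact: sqr_ge0.
have -> : \sum_i (A * b i - C * a i) ^+ 2 = A ^+ 2 * B - 2 * (A * C) * C + C ^+ 2 * A.
  rewrite (eq_bigr (fun i => A ^+ 2 * b i ^+ 2 - 2 * (A * C) * (a i * b i)
    + C ^+ 2 * a i ^+ 2)); last by move=> i _; ring.
  by rewrite big_split sumrB/= -!mulr_sumr.
have A0 : 0 < A by rewrite lt_neqAle eq_sym An0.
rewrite (_ : _ + _ = A * (A * B - C ^+ 2)); last by ring.
by rewrite pmulr_rge0// subr_ge0.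
Qed.

Lemma continuous_powR_pos (T : topologicalType) (g : T -> R) (r : R) :
  continuous g -> (forall x, 0 < g x) -> continuous (fun x => g x `^ r).
Proof.
move=> cg g0 x; apply: (@continuous_comp _ _ _ g (@powR R ^~ r)); first exact: cg.
apply: differentiable_continuous; apply/derivable1_diffP.
by apply: ex_derive; exact: is_derive1_powR.
Qed.

Lemma continuous_sqr_enorm n : continuous (fun x : 'rV[R]_n => enorm x ^+ 2).
Proof.
rewrite (_ : (fun _ => _) = fun x : 'rV[R]_n => \sum_(i < n) x ord0 i ^+ 2).
  by apply: continuous_sum => i; apply: continuous_mul; exact: coord_continuous.
by apply/funext => x; exact: sqr_enorm.
Qed.

Lemma is_derive_sqr_enorm n (x : 'rV[R]_n) k :
  is_derive x (delta_mx ord0 k) (fun x => enorm x ^+ 2) (2 * x ord0 k).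
Proof.
have h i := is_derive_sqr (is_derive_coord i k x).
have := is_derive_bigsum (index_enum 'I_n) h.
congr (is_derive _ _ _ _); first by apply/funext => y; rewrite sqr_enorm.
rewrite (bigD1 k)//= eqxx mulr1 big1 ?addr0// => i /negbTE ->.
by rewrite !mulr0.
Qed.

End enorm_facts.

Section hardy.
Context {R : realType}.

Definition C1_vanishing n m M (f : 'rV[R]_n -> 'rV[R]_m) := forall j,
  [/\ continuous (fun x => f x ord0 j),
      (forall x k, derivable (fun y => f y ord0 j) x (delta_mx ord0 k)),
      (forall k, continuous (partial k (fun y => f y ord0 j))) &
      vanishes_outside M (fun x => f x ord0 j)].

(** Half of the k-th partial derivative of |f|^2, that is |f| d_k |f|; unlike
    d_k |f| it is continuous across the zeros of a C^1 field f. *)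
Definition half_partial_sqr n m (f : 'rV[R]_n -> 'rV[R]_m) k x :=
  \sum_j f x ord0 j * partial k (fun y => f y ord0 j) x.

(** The Euclidean norm of the gradient of |f| where f does not vanish, and 0
    elsewhere since 0^-1 = 0. *)
Definition modulus_gradient n m (f : 'rV[R]_n -> 'rV[R]_m) x :=
  enorm (\row_k half_partial_sqr f k x) / enorm (f x).

(** A smooth substitute for |x|^(-q) when 0 < q: for x <> 0 it increases to
    |x|^(-q) as e > 0 decreases to 0. *)
Definition weight n (q e : R) (x : 'rV[R]_n) := (enorm x ^+ 2 + e) `^ (- (q / 2)).

Section fixed.
Context (n m : nat) (M : R) (f : 'rV[R]_n -> 'rV[R]_m) (fC : C1_vanishing M f).

Lemma continuous_half_partial_sqr k : continuous (half_partial_sqr f k).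
Proof.
by apply: continuous_sum => j; apply: continuous_mul; have [] := fC j.
Qed.

Lemma continuous_sqr_enorm_field : continuous (fun x => enorm (f x) ^+ 2).
Proof.
rewrite (_ : (fun _ => _) = fun x : 'rV[R]_n => \sum_(i < m) f x ord0 i ^+ 2).
  by apply: continuous_sum => i; apply: continuous_mul; have [] := fC i.
by apply/funext => x; exact: sqr_enorm.
Qed.

Lemma is_derive_sqr_enorm_field x k :
  is_derive x (delta_mx ord0 k) (fun x => enorm (f x) ^+ 2) (2 * half_partial_sqr f k x).
Proof.
have h j : is_derive x (delta_mx ord0 k) (fun y => f y ord0 j ^+ 2)
    (2 * (f x ord0 j * partial k (fun y => f y ord0 j) x)).
  by apply: is_derive_sqr; apply: derivableP; have [] := fC j.
have := is_derive_bigsum (index_enum 'I_m) h.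
congr (is_derive _ _ _ _); first by apply/funext => y; rewrite sqr_enorm.
by rewrite -mulr_sumr.
Qed.

Lemma enorm_field_vanishes x : ~ box n M x -> enorm (f x) = 0.
Proof.
move=> xM; apply/eqP; rewrite -sqrf_eq0 sqr_enorm big1// => j _.
by have [_ _ _ ->] := fC j; rewrite // expr0n.
Qed.

(** The condition 2 < p makes |f|^p = (|f|^2)^(p/2) differentiable also at the
    zeros of f. *)
Lemma is_derive_enorm_powR p x k : 2 < p ->
  is_derive x (delta_mx ord0 k) (fun x => enorm (f x) `^ p)
    (p * enorm (f x) `^ (p - 2) * half_partial_sqr f k x).
Proof.
move=> p2.
have a1 : 1 < p / 2 by rewrite ltr_pdivlMr// mul1r.
have := is_derive_comp_real (is_derive_sqr_enorm_field x k)
  (is_derive_odd_powR a1 (sqr_ge0 (enorm (f x)))).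
congr (is_derive _ _ _ _).
  apply/funext => y /=; rewrite odd_powRE ?sqr_ge0// ?divr_gt0//.
    by rewrite -enorm_powR.
  exact: lt_trans p2.
rewrite ger0_norm ?sqr_ge0// (_ : p / 2 - 1 = (p - 2) / 2).
  by rewrite -enorm_powR; field.
by field.
Qed.

Lemma continuous_enorm_powR r : 0 < r -> continuous (fun x => enorm (f x) `^ r).
Proof.
move=> r0.
rewrite (_ : (fun _ => _) = (fun s : R => `|s| `^ (r / 2)) \o (fun x => enorm (f x) ^+ 2)).
  move=> x; apply: continuous_comp; first exact: continuous_sqr_enorm_field.
  by apply: continuous_norm_powR; rewrite divr_gt0.
by apply/funext => x /=; rewrite ger0_norm ?sqr_ge0// -enorm_powR.
Qed.

End fixed.

Section weights.
Context (n : nat) (q e : R) (e0 : 0 < e).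

Lemma sqr_enormD_gt0 (x : 'rV[R]_n) : 0 < enorm x ^+ 2 + e.
Proof. by rewrite ltr_wpDl// sqr_ge0. Qed.

Lemma continuous_sqr_enormD_powR r : continuous (fun x : 'rV[R]_n => (enorm x ^+ 2 + e) `^ r).
Proof.
apply: continuous_powR_pos; last exact: sqr_enormD_gt0.
apply: continuous_add; first exact: continuous_sqr_enorm.
by move=> x; exact: cst_continuous.
Qed.

Lemma is_derive_weight (x : 'rV[R]_n) k :
  is_derive x (delta_mx ord0 k) (weight q e)
    (- q * (enorm x ^+ 2 + e) `^ (- (q / 2) - 1) * x ord0 k).
Proof.
have h : is_derive x (delta_mx ord0 k) (fun y : 'rV[R]_n => enorm y ^+ 2 + e) (2 * x ord0 k).
  have := is_deriveD (is_derive_sqr_enorm x k) (is_derive_cst e x (delta_mx ord0 k)).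
  by congr (is_derive _ _ _ _); rewrite addr0.
have := is_derive_comp_real h (is_derive1_powR (- (q / 2)) (sqr_enormD_gt0 x)).
by congr (is_derive _ _ _ _); field.
Qed.

Lemma is_derive_coord_weight (x : 'rV[R]_n) k :
  is_derive x (delta_mx ord0 k) (fun y => y ord0 k * weight q e y)
    (weight q e x - q * (enorm x ^+ 2 + e) `^ (- (q / 2) - 1) * x ord0 k ^+ 2).
Proof.
have := is_deriveM (is_derive_coord k k x) (is_derive_weight x k).
congr (is_derive _ _ _ _); rewrite eqxx /GRing.scale/=; ring.
Qed.

End weights.

End hardy.

(** * Measurability and the pointwise radial bound *)

Section measurability.
Context {R : realType} {n : nat}.

Lemma continuous_enorm_comp m (g : 'rV[R]_n -> 'rV[R]_m) :
  (forall j, continuous (fun x => g x ord0 j)) -> continuous (fun x => enorm (g x)).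
Proof.
move=> cg x; apply: (@continuous_comp _ _ _ (fun x => \sum_i g x ord0 i ^+ 2) Num.sqrt).
  by apply: continuous_sum => i; apply: continuous_mul; exact: cg.
exact: sqrt_continuous.
Qed.

Lemma measurable_enorm_powR m (g : 'rV[R]_n -> 'rV[R]_m) r :
  (forall j, continuous (fun x => g x ord0 j)) -> measurable_fun setT (fun x => enorm (g x) `^ r).
Proof.
move=> cg; apply: (measurableT_comp (measurable_powR r)).
exact: (continuous_measurable_rV (continuous_enorm_comp cg)).
Qed.

End measurability.

Section hardy.
Context {R : realType} (n m : nat) (M : R) (f : 'rV[R]_n -> 'rV[R]_m).
Hypothesis fC : C1_vanishing M f.

Lemma measurable_modulus_gradient : measurable_fun setT (modulus_gradient f).
Proof.
rewrite (_ : modulus_gradient f = fun x =>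
  enorm (\row_k half_partial_sqr f k x) `^ 1 * enorm (f x) `^ (- 1)); last first.
  by apply/funext => x; rewrite powRr1 ?powR_inv1 ?enorm_ge0.
apply: measurable_funM; apply: measurable_enorm_powR => j; last by have [] := fC j.
rewrite (_ : (fun _ => _) = half_partial_sqr f j); last by apply/funext => x; rewrite mxE.
exact: (@continuous_half_partial_sqr _ _ _ _ _ fC j).
Qed.

Lemma measurable_field_powR_div a b :
  measurable_fun setT (fun x => enorm (f x) `^ a / enorm x `^ b).
Proof.
rewrite (_ : (fun _ => _) = fun x => enorm (f x) `^ a * enorm x `^ (- b)); last first.
  by apply/funext => x; rewrite powRN.
apply: measurable_funM; apply: measurable_enorm_powR => j; first by have [] := fC j.
exact: coord_continuous.
Qed.

(** Where f does not vanish, the sum over k is at most |x| |f| times the norm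
    of the gradient of |f|, and the weight is at most |x|^(-q). At x = 0 the
    sum is 0, and at the zeros of f the power of order p - 2 is 0. *)
Lemma radial_bound p q e x : 2 < p -> 0 < q -> 0 < e ->
  `|enorm (f x) `^ (p - 2) * weight q e x * \sum_k x ord0 k * half_partial_sqr f k x| <=
  enorm (f x) `^ (p - 1) / enorm x `^ (q - 1) * modulus_gradient f x.
Proof.
move=> p2 q0 e0.
have [fx0|fx0] := eqVneq (enorm (f x)) 0.
  rewrite fx0 powR0 ?subr_eq0 ?gt_eqF// !mul0r normr0.
  by rewrite mulr_ge0// divr_ge0 ?powR_ge0 ?enorm_ge0.
set G := enorm (\row_k half_partial_sqr f k x).
have G0 : 0 <= G by exact: enorm_ge0.
have hG : `|\sum_k x ord0 k * half_partial_sqr f k x| <= enorm x * G.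
  apply: le_trans (cauchy_schwarz_sum _ _) _; rewrite -/(enorm x).
  rewrite (_ : G = Num.sqrt (\sum_k half_partial_sqr f k x ^+ 2))//.
  by congr Num.sqrt; apply: eq_bigr => k _; rewrite mxE.
have hw : weight q e x * enorm x <= (enorm x `^ (q - 1))^-1.
  have [->|x0] := eqVneq (enorm x) 0; first by rewrite mulr0 invr_ge0 powR_ge0.
  have xp : 0 < enorm x by rewrite lt_neqAle eq_sym x0 enorm_ge0.
  rewrite -powRN opprB addrC powRD ?x0 ?implybT// powRr1 ?enorm_ge0//.
  rewrite ler_wpM2r ?enorm_ge0// /weight !powRN.
  rewrite lef_pV2 ?posrE ?powR_gt0// ?sqr_enormD_gt0//.
  rewrite enorm_powR ge0_ler_powR ?nnegrE ?divr_ge0 ?sqr_ge0 ?ltW//.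
    exact: sqr_enormD_gt0.
  by rewrite ltrDl.
rewrite normrM ger0_norm; last by rewrite mulr_ge0 ?powR_ge0.
rewrite (@le_trans _ _ (enorm (f x) `^ (p - 2) * weight q e x * (enorm x * G)))//.
  by rewrite ler_wpM2l// mulr_ge0 ?powR_ge0.
have -> : enorm (f x) `^ (p - 1) = enorm (f x) `^ (p - 2) * enorm (f x).
  rewrite -[X in _ = _ * X]powRr1 ?enorm_ge0// -powRD ?fx0 ?implybT//.
  by congr (_ `^ _); ring.
rewrite /modulus_gradient -/G -!mulrA ler_wpM2l ?powR_ge0//.
rewrite [leRHS](_ : _ = (enorm x `^ (q - 1))^-1 * G).
  by rewrite mulrA ler_wpM2r.
by rewrite mulrCA; congr (_ * _); rewrite mulrC divfK.
Qed.

End hardy.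

(** * The weighted Hardy inequality with a regular weight *)

Section hardy_integral.
Context {R : realType} (n m : nat) (M : R) (f : 'rV[R]_n -> 'rV[R]_m).
Hypothesis fC : C1_vanishing M f.
Context (p q : R) (p2 : 2 < p) (q0 : 0 < q) (qn : q < n%:R).

Let F x := enorm (f x) `^ p.

Let p_gt0 : 0 < p. Proof. exact: lt_trans p2. Qed.

Lemma partial_enorm_powR k :
  partial k F = fun x => p * enorm (f x) `^ (p - 2) * half_partial_sqr f k x.
Proof.
by apply/funext => x; apply: (@derive_val _ _ _ _ _ _ _ (is_derive_enorm_powR fC x k p2)).
Qed.

(** The function is the divergence of the vector field |f|^p * weight * x,
    which is C^1 with compact support. *)
Lemma hardy_divergence_null e : 0 < e -> null_integral (fun x =>
  F x * (n%:R * weight q e x - q * (enorm x ^+ 2 + e) `^ (- (q / 2) - 1) * enorm x ^+ 2) +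
  p * (enorm (f x) `^ (p - 2) * weight q e x * \sum_k x ord0 k * half_partial_sqr f k x)).
Proof.
move=> e0.
pose g k (x : 'rV[R]_n) := x ord0 k * weight q e x.
have dg (k : 'I_n) (x : 'rV[R]_n) := is_derive_coord_weight q e0 x k.
have dgE k : partial k (g k) = fun x =>
    weight q e x - q * (enorm x ^+ 2 + e) `^ (- (q / 2) - 1) * x ord0 k ^+ 2.
  by apply/funext => x; apply: (@derive_val _ _ _ _ _ _ _ (dg k x)).
have cw r := continuous_sqr_enormD_powR e0 r (n := n).
have cx k : continuous (fun x : 'rV[R]_n => x ord0 k) by exact: coord_continuous.
have cc (c : R) : continuous (fun _ : 'rV[R]_n => c) by move=> x; exact: cst_continuous.
have cF r : 0 < r -> continuous (fun x => enorm (f x) `^ r).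
  by move=> r0; exact: (continuous_enorm_powR fC r0).
have p20 : 0 < p - 2 by rewrite subr_gt0.
have N k : null_integral (fun x => partial k F x * g k x + F x * partial k (g k) x).
  apply: (@null_integral_partialM _ _ M).
  - by move=> x; apply: (@ex_derive _ _ _ _ _ _ _ (is_derive_enorm_powR fC x k p2)).
  - by move=> x; apply: (@ex_derive _ _ _ _ _ _ _ (dg k x)).
  - exact: cF.
  - by apply: continuous_mul; [exact: cx|exact: cw].
  - rewrite partial_enorm_powR; apply: continuous_mul.
      by apply: continuous_mul => //; exact: cF.
    exact: (@continuous_half_partial_sqr _ _ _ _ _ fC k).
  - rewrite dgE.
    rewrite (_ : (fun _ => _) = fun x : 'rV[R]_n => weight q e x +
        (- q * (enorm x ^+ 2 + e) `^ (- (q / 2) - 1)) * (x ord0 k * x ord0 k)).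
      apply: continuous_add; first exact: cw.
      apply: continuous_mul; apply: continuous_mul; [exact: cc|exact: cw|exact: cx|exact: cx].
    by apply/funext => x; rewrite expr2; ring.
  - by move=> x xM; rewrite /F (enorm_field_vanishes fC xM) powR0 ?gt_eqF.
have := null_integral_sum N; congr null_integral; apply/funext => x.
under eq_bigr do rewrite partial_enorm_powR dgE.
rewrite big_split/= addrC -!mulr_sumr; congr (_ + _).
  congr (_ * _); rewrite sumrB sumr_const card_ord -[weight _ _ _ *+ n]mulr_natl -mulr_sumr.
  by rewrite sqr_enorm.
rewrite [RHS]mulrA mulr_sumr; apply: eq_bigr => k _.
by rewrite /g; ring.
Qed.

(** The divergence of weight * x is at least (n - q) * weight, because
    |x|^2 <= |x|^2 + e. Integrating the divergence of |f|^p * weight * x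
    therefore bounds (n - q) times the left integral by the integral of
    - p |f|^(p-2) weight times the sum over k of x_k (f . d_k f), which
    radial_bound controls. *)
Lemma hardy_weight e : 0 < e ->
  ((n%:R - q)%:E * \int[leb n]_x (F x * weight q e x)%:E <=
   p%:E * \int[leb n]_x (enorm (f x) `^ (p - 1) / enorm x `^ (q - 1)
                          * modulus_gradient f x)%:E)%E.
Proof.
move=> e0.
have cw r := continuous_sqr_enormD_powR e0 r (n := n).
have cF r : 0 < r -> continuous (fun x => enorm (f x) `^ r).
  by move=> r0; exact: (continuous_enorm_powR fC r0).
have p20 : 0 < p - 2 by rewrite subr_gt0.
have nq0 : 0 < n%:R - q by rewrite subr_gt0.
pose B x :=
  p * (enorm (f x) `^ (p - 2) * weight q e x * \sum_k x ord0 k * half_partial_sqr f k x).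
pose H x := enorm (f x) `^ (p - 1) / enorm x `^ (q - 1) * modulus_gradient f x.
have H0 x : 0 <= H x.
  by rewrite mulr_ge0 ?divr_ge0 ?powR_ge0 ?enorm_ge0.
have mH : measurable_fun setT H.
  apply: measurable_funM; last exact: (measurable_modulus_gradient fC).
  exact: (measurable_field_powR_div fC).
have BH x : `|B x| <= p * H x.
  by rewrite normrM gtr0_norm// ler_pM2l//; exact: radial_bound.
have cB : continuous B.
  apply: continuous_mul; first by move=> x; exact: cst_continuous.
  apply: continuous_mul; first by apply: continuous_mul; [exact: cF|exact: cw].
  apply: continuous_sum => k; apply: continuous_mul; first exact: coord_continuous.
  exact: (@continuous_half_partial_sqr _ _ _ _ _ fC k).
have BM : vanishes_outside M B.
  move=> x xM; rewrite /B (enorm_field_vanishes fC xM) powR0 ?gt_eqF//.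
  by rewrite !mul0r mulr0.
have iB : (leb n).-integrable setT (EFin \o (fun x => - B x)).
  apply: (@integrable_continuous _ _ M); first by move=> x; exact: (continuousN (cB x)).
  by move=> x xM; rewrite BM// oppr0.
have cFw : continuous (fun x => F x * weight q e x).
  by apply: continuous_mul; [exact: cF|exact: cw].
have Fw0 x : 0 <= F x * weight q e x by rewrite mulr_ge0 ?powR_ge0.
rewrite -ge0_integralZl//; last 3 first.
- by apply/measurable_EFinP; exact: continuous_measurable_rV.
- by move=> x _; rewrite lee_fin.
- by rewrite lee_fin ltW.
pose T x := F x * (n%:R * weight q e x
  - q * (enorm x ^+ 2 + e) `^ (- (q / 2) - 1) * enorm x ^+ 2) + B x.
have N : null_integral T := hardy_divergence_null e0.
have hT := integral_add_null iB N.
apply: (@le_trans _ _ (\int[leb n]_x (- B x + T x)%:E)%E).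
  apply: ge0_le_integral => //.
  - by move=> x _; rewrite lee_fin mulr_ge0// ltW.
  - apply/measurable_EFinP; apply: measurable_funM => //.
    exact: continuous_measurable_rV.
  - have [/integrableP[mT _] _] := N.
    have /integrableP[mB _] := iB.
    apply/measurable_EFinP; apply: measurable_funD; exact/measurable_EFinP.
  - move=> x _; rewrite -EFinM lee_fin /T addrCA addNr addr0.
    rewrite mulrCA ler_wpM2l ?powR_ge0// mulrBl lerB// -mulrA ler_wpM2l ?(ltW q0)//.
    have N0 := sqr_enormD_gt0 e0 x.
    have -> : weight q e x = (enorm x ^+ 2 + e) `^ (- (q / 2) - 1) * (enorm x ^+ 2 + e).
      rewrite -[X in _ * X]powRr1 ?(ltW N0)// -powRD ?subrK//.
      by apply/implyP => _; rewrite gt_eqF.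
    rewrite ler_wpM2l ?powR_ge0//.
    by rewrite lerDl (ltW e0).
rewrite hT -ge0_integralZl//; last 3 first.
- exact/measurable_EFinP.
- by move=> x _; rewrite lee_fin; exact: H0.
- by rewrite lee_fin ltW.
apply: le_trans (lee_abs _) _.
apply: le_trans (le_abse_integral _ _ _) _ => //.
  by have /integrableP[] := iB.
apply: ge0_le_integral => //.
- by have /integrableP[mB _] := iB; apply: measurableT_comp.
- by apply/measurable_EFinP; apply: measurable_funM.
- by move=> x _; rewrite abse_EFin -EFinM lee_fin normrN.
Qed.

End hardy_integral.

(** * The weighted Hardy inequality *)

Section fatou_bound.
Context d (T : measurableType d) (R : realType) (mu : {measure set T -> \bar R}).
Local Open Scope ereal_scope.

Lemma limn_einf_ge (v : (\bar R)^nat) (c : \bar R) :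
  (forall i, c <= v i) -> c <= limn_einf v.
Proof.
move=> cv; rewrite limn_einf_lim; apply: lime_ge; first exact: is_cvg_einfs.
by apply: nearW => i; apply: le_ereal_inf_tmp => _ [j _ <-].
Qed.

Lemma limn_einf_le (v : (\bar R)^nat) (c : \bar R) :
  (forall i, v i <= c) -> limn_einf v <= c.
Proof.
move=> vc; rewrite limn_einf_lim; apply: lime_le; first exact: is_cvg_einfs.
apply: nearW => i; apply: le_trans (vc i).
by apply: ereal_inf_lbound; exists i => /=.
Qed.

Lemma integral_le_liminf (f : nat -> T -> \bar R) (g : T -> \bar R) (c : \bar R) :
  (forall i, measurable_fun setT (f i)) -> measurable_fun setT g ->
  (forall i x, 0 <= f i x) -> (forall x, 0 <= g x) ->
  (forall x, g x <= limn_einf (f ^~ x)) ->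
  (forall i, \int[mu]_x f i x <= c) -> \int[mu]_x g x <= c.
Proof.
move=> mf mg f0 g0 gf fc.
apply: (@le_trans _ _ (\int[mu]_x limn_einf (f ^~ x))).
  apply: ge0_le_integral => //.
  rewrite /limn_einf; apply: measurableT_comp => //.
  apply: (@measurable_fun_limn_esup _ _ _ _ (fun i x => - f i x)) => i.
  exact: measurableT_comp.
apply: le_trans (fatou mu measurableT mf _) _ => //.
exact: limn_einf_le.
Qed.
End fatou_bound.

Section hardy.
Context {R : realType} (n m : nat) (M : R) (f : 'rV[R]_n -> 'rV[R]_m).
Hypothesis fC : C1_vanishing M f.

(** The constants in hardy_weight do not depend on e, so Fatou's lemma applies
    along e = 1/(i+1). The weights converge to |x|^(-q) at every x <> 0; at
    x = 0 the integrand on the left is 0 by the convention 0^-1 = 0, so that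
    it is below any lower limit. *)
Lemma hardy p q : 2 < p -> 0 < q -> q < n%:R ->
  ((n%:R - q)%:E * \int[leb n]_x (enorm (f x) `^ p / enorm x `^ q)%:E <=
   p%:E * \int[leb n]_x (enorm (f x) `^ (p - 1) / enorm x `^ (q - 1)
                          * modulus_gradient f x)%:E)%E.
Proof.
move=> p2 q0 qn.
have nq0 : 0 < n%:R - q by rewrite subr_gt0.
rewrite -lee_pdivlMl//.
apply: (integral_le_liminf (f := fun i x =>
    (enorm (f x) `^ p * weight q i.+1%:R^-1 x)%:E)).
- move=> i; apply/measurable_EFinP; apply: measurable_funM.
    by apply: measurable_enorm_powR => j; have [] := fC j.
  apply: continuous_measurable_rV.
  by apply: (@continuous_sqr_enormD_powR R n i.+1%:R^-1); rewrite invr_gt0.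
- by apply/measurable_EFinP; exact: (measurable_field_powR_div fC).
- by move=> i x; rewrite lee_fin mulr_ge0 ?powR_ge0.
- by move=> x; rewrite lee_fin divr_ge0 ?powR_ge0.
- move=> x; have [x0|x0] := eqVneq (enorm x) 0.
    rewrite x0 powR0 ?gt_eqF// invr0 mulr0; apply: limn_einf_ge => i.
    by rewrite lee_fin mulr_ge0 ?powR_ge0.
  have s0 : 0 < enorm x ^+ 2 by rewrite exprn_gt0// lt_neqAle eq_sym x0 enorm_ge0.
  have c : weight q i.+1%:R^-1 x @[i --> \oo] --> (enorm x `^ q)^-1.
    rewrite -powRN enorm_powR mulNr.
    have cp : {for enorm x ^+ 2, continuous (@powR R ^~ (- (q / 2)))}.
      apply: differentiable_continuous; apply/derivable1_diffP.
      by apply: ex_derive; exact: is_derive1_powR.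
    apply: (continuous_cvg _ cp).
    rewrite -[X in _ --> X]addr0; apply: cvgD; first exact: cvg_cst.
    exact: cvg_harmonic.
  have cE : ((enorm (f x) `^ p * weight q i.+1%:R^-1 x)%:E @[i --> \oo]
             --> (enorm (f x) `^ p / enorm x `^ q)%:E)%E.
    apply: cvg_EFin; first by apply: nearW.
    by apply: cvgM => //; exact: cvg_cst.
  by rewrite (cvg_limn_einf_sup cE).1.
- move=> i; rewrite lee_pdivlMl//.
  by apply: (hardy_weight fC) => //; rewrite invr_gt0.
Qed.

End hardy.

(** * The Cauchy-Schwarz inequality and the polar decomposition *)

Section cauchy_schwarz.
Context d (T : measurableType d) (R : realType) (mu : {measure set T -> \bar R}).
Local Open Scope ereal_scope.

Lemma poweR_sqr (x : \bar R) : 0 <= x -> x `^ 2 = x ^+ 2.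
Proof.
case: x => [r| |]//.
  by rewrite lee_fin => r0; rewrite poweR_EFin powR_mulrn// EFin_expe.
by move=> _; rewrite poweRyr// expe2 mulyy.
Qed.

(** Hoelder's inequality with both exponents equal to 2. The integrals may be
    infinite: the product of 0 and +oo is 0, which is right here since a
    function whose square has integral 0 vanishes almost everywhere. *)
Lemma integral_cauchy_schwarz (g h : T -> R) :
  measurable_fun setT g -> measurable_fun setT h ->
  (forall x, 0 <= g x)%R -> (forall x, 0 <= h x)%R ->
  (\int[mu]_x (g x * h x)%:E) ^+ 2 <=
  \int[mu]_x (g x ^+ 2)%:E * \int[mu]_x (h x ^+ 2)%:E.
Proof.
move=> mg mh g0 h0.
have L2 (k : T -> R) : (forall x, 0 <= k x)%R ->
    ('N[mu]_2%:E[EFin \o k]) ^+ 2 = \int[mu]_x (k x ^+ 2)%:E.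
  move=> k0; rewrite -poweR_sqr ?Lnorm_ge0// powR_Lnorm//.
  by apply: eq_integral => x _; rewrite /= ger0_norm// powR_mulrn.
have -> : \int[mu]_x (g x * h x)%:E = 'N[mu]_1[EFin \o (g \* h)%R].
  by rewrite Lnorm1; apply: eq_integral => x _; rewrite /= ger0_norm// mulr_ge0.
have half : (2^-1 + 2^-1 = 1 :> R)%R by rewrite [RHS]splitr mul1r.
have H := hoelder mu mg mh (ltr0Sn R 1) (ltr0Sn R 1) half.
rewrite -(L2 g g0) -(L2 h h0) !expe2 muleACA -!expe2 lee_sqr//.
- exact: Lnorm_ge0.
- by rewrite mule_ge0// Lnorm_ge0.
Qed.

End cauchy_schwarz.

Section lagrange.
Context {R : realType}.

(** The summand is symmetric in j and l and zero for j = l, so the left side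
    is half of the sum over all pairs, which expands into products of sums. *)
Lemma lagrange_identity m (a b : 'I_m -> R) :
  \sum_(j < m) \sum_(l < m | (j < l)%N) (a l * b j - a j * b l) ^+ 2 =
  (\sum_j a j ^+ 2) * (\sum_j b j ^+ 2) - (\sum_j a j * b j) ^+ 2.
Proof.
set S := \sum_j \sum_(l < m | _) _.
pose t j l := (a l * b j - a j * b l) ^+ 2.
have E : \sum_j \sum_l t j l = S + S.
  rewrite {2}/S [X in _ = _ + X](exchange_big_dep predT)//= -big_split/=; apply: eq_bigr => j _.
  rewrite (bigID (fun l : 'I_m => (j < l)%N))/=; congr (_ + _).
  rewrite (bigD1 j) ?ltnn//= {1}/t subrr expr0n add0r.
  apply: eq_big => [l|l _]; first by rewrite -leqNgt ltn_neqAle andbC.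
  by rewrite /t; ring.
have -> : S = (\sum_j \sum_l t j l) / 2 by rewrite E; field.
set A := \sum_j a j ^+ 2; set B := \sum_j b j ^+ 2; set C := \sum_j a j * b j.
have -> : \sum_j \sum_l t j l = 2 * (A * B - C ^+ 2).
  rewrite (eq_bigr (fun j => b j ^+ 2 * A + a j ^+ 2 * B - 2 * C * (a j * b j))).
    rewrite sumrB big_split/= -!mulr_suml -mulr_sumr -/A -/B -/C; ring.
  move=> j _; rewrite /A /B /C !mulr_sumr mulr_suml -big_split -sumrB/=.
  by apply: eq_bigr => l _; rewrite /t; ring.
by rewrite mulrC mulKf.
Qed.

(** Polar decomposition of the derivative: where f does not vanish this is an
    equality, by the Lagrange identity applied for each k to the vectors f and
    d_k f. At the zeros of f the left side is 0. *)
Lemma modulus_phase_split n m (f : 'rV[R]_n -> 'rV[R]_m) x :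
  modulus_gradient f x ^+ 2 + (enorm (f x) * phase_derivative f x) ^+ 2 <=
  \sum_j \sum_k partial k (fun y => f y ord0 j) x ^+ 2.
Proof.
have [fx0|fx0] := eqVneq (enorm (f x)) 0.
  rewrite /modulus_gradient fx0 invr0 mulr0 mul0r !expr0n addr0.
  by apply: sumr_ge0 => j _; apply: sumr_ge0 => k _; exact: sqr_ge0.
pose a j := f x ord0 j; pose b k j := partial k (fun y => f y ord0 j) x.
set N := enorm (f x) in fx0 *.
have NE : N ^+ 2 = \sum_j a j ^+ 2 by rewrite sqr_enorm.
have P2 : phase_derivative f x ^+ 2 = N ^- 4 *
    \sum_k (N ^+ 2 * (\sum_j b k j ^+ 2) - half_partial_sqr f k x ^+ 2).
  rewrite /phase_derivative sqr_sqrtr; last first.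
    by apply: sumr_ge0 => k _; apply: sumr_ge0 => j _; apply: sumr_ge0 => l _; exact: sqr_ge0.
  rewrite mulr_sumr; apply: eq_bigr => k _.
  rewrite NE -lagrange_identity mulr_sumr; apply: eq_bigr => j _.
  rewrite mulr_sumr; apply: eq_bigr => l _.
  by rewrite -/N -/(a l) -/(a j) -/(b k j) -/(b k l) -NE; field.
rewrite [(N * _) ^+ 2]exprMn P2 /modulus_gradient -/N expr_div_n sqr_enorm.
rewrite (eq_bigr (fun k => half_partial_sqr f k x ^+ 2)); last by move=> k _; rewrite mxE.
rewrite sumrB -mulr_sumr exchange_big/= -/N.
set D := \sum_k half_partial_sqr f k x ^+ 2; set B := \sum_k \sum_j _.
by rewrite le_eqVlt; apply/orP; left; apply/eqP; field.
Qed.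

Lemma measurable_phase_derivative n m M (f : 'rV[R]_n -> 'rV[R]_m) :
  C1_vanishing M f -> measurable_fun setT (phase_derivative f).
Proof.
move=> fC; apply: (measurableT_comp (continuous_measurable_fun (@sqrt_continuous R))).
have mdiv l : measurable_fun setT (fun x => f x ord0 l / enorm (f x) ^+ 2).
  rewrite (_ : (fun _ => _) = fun x => f x ord0 l * enorm (f x) `^ (- 2)).
    apply: measurable_funM.
      by apply: continuous_measurable_rV; have [] := fC l.
    by apply: measurable_enorm_powR => j; have [] := fC j.
  by apply/funext => x; rewrite powR_invn ?enorm_ge0.
have md k j : measurable_fun setT (partial k (fun y => f y ord0 j)).
  by apply: continuous_measurable_rV; have [] := fC j.
apply: measurable_sum => k; apply: measurable_sum => j.
rewrite [X in measurable_fun _ X](_ : _ = fun x => \sum_(l < m) if (j < l)%N then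
   (f x ord0 l / enorm (f x) ^+ 2 * partial k (fun y => f y ord0 j) x
     - f x ord0 j / enorm (f x) ^+ 2 * partial k (fun y => f y ord0 l) x) ^+ 2 else 0); last first.
  by apply/funext => x; rewrite big_mkcond.
apply: measurable_sum => l; case: (j < l)%N; last exact: measurable_cst.
apply: measurable_funX; apply: measurable_funB; exact: measurable_funM.
Qed.

End lagrange.

(** * The inequality *)

Lemma gradient_C1_vanishing (R : realType) n M (u : 'rV[R]_n -> R) :
  smooth u -> vanishes_outside M u -> C1_vanishing M (gradient u).
Proof.
move=> su uM j.
have -> : (fun x => gradient u x ord0 j) = partial j u.
  by apply/funext => x; rewrite mxE.
have sj := smooth_partial j su.
split.
- exact: smooth_continuous.
- by move=> x k; exact: (@smooth_derivable _ _ _ x k sj).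
- by move=> k; apply: smooth_continuous; exact: smooth_partial.
- exact: partial_vanishes_outside.
Qed.

Unset Implicit Arguments.

(* All integrands are nonnegative; the integrals are taken in \bar R. *)
Theorem corollary1p6 (R : realType) (n : nat) (p q : R) (u : 'rV[R]_n -> R)
    (u_smooth : smooth u) (u_supp : compactly_supported u)
    (q_gt0 : 0 < q) (q_lt2 : q < 2) (p_gt2 : 2 < p)
    (n_gt2 : (2 < n)%N) (n_lt : n%:R < 2 * (p - q) / (p - 2)) :
  ((((n%:R - q) ^+ 2 / p ^+ 2)%:E
      * (\int[lebesgue_measure_rV n]_x
           (enorm (gradient u x) `^ p / enorm x `^ q)%:E) ^+ 2
    + (\int[lebesgue_measure_rV n]_x
         (enorm (gradient u x) `^ p / enorm x `^ (q - 1)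
          * phase_derivative (gradient u) x)%:E) ^+ 2)
   <= (\int[lebesgue_measure_rV n]_x (`|laplacian u x| ^+ 2)%:E)
      * (\int[lebesgue_measure_rV n]_x
          (enorm (gradient u x) `^ (2 * p - 2) / enorm x `^ (2 * q - 2))%:E))%E.
Proof.
rewrite !lebE.
have [M uM] := compactly_supported_vanishes u_supp.
have fC := gradient_C1_vanishing u_smooth uM.
set f := gradient u in fC *.
have p0 : 0 < p by rewrite (lt_trans _ p_gt2).
have q_ltn : q < n%:R by rewrite (lt_trans q_lt2)// ltr_nat.
(* the three factors to which the Cauchy-Schwarz inequality is applied *)
pose w x := enorm (f x) `^ (p - 1) / enorm x `^ (q - 1).
pose G x := modulus_gradient f x.
pose Q x := enorm (f x) * phase_derivative f x.
have w0 x : 0 <= w x by rewrite divr_ge0 ?powR_ge0.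
have G0 x : 0 <= G x by rewrite divr_ge0 ?enorm_ge0.
have Q0 x : 0 <= Q x by rewrite mulr_ge0 ?enorm_ge0 ?sqrtr_ge0.
have mw : measurable_fun setT w by exact: (measurable_field_powR_div fC).
have mG : measurable_fun setT G by exact: (measurable_modulus_gradient fC).
have mQ : measurable_fun setT Q.
  apply: measurable_funM; last exact: (measurable_phase_derivative fC).
  by apply: continuous_measurable_rV; apply: continuous_enorm_comp => j; have [] := fC j.
have -> : (\int[leb n]_x (enorm (f x) `^ (2 * p - 2) / enorm x `^ (2 * q - 2))%:E
           = \int[leb n]_x (w x ^+ 2)%:E)%E.
  apply: eq_integral => x _; congr (_%:E).
  rewrite /w expr_div_n -!powR_mulrn ?powR_ge0// -!powRrM.
  by congr (_ `^ _ / _ `^ _); ring.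
have -> : (\int[leb n]_x (enorm (f x) `^ p / enorm x `^ (q - 1) * phase_derivative f x)%:E
           = \int[leb n]_x (w x * Q x)%:E)%E.
  apply: eq_integral => x _; congr (_%:E).
  by rewrite /w /Q -(mulr_powRB1 (enorm_ge0 (f x)) p0); ring.
set W := (\int[leb n]_x (w x ^+ 2)%:E)%E.
have W0 : (0 <= W)%E by apply: integral_ge0 => x _; rewrite lee_fin sqr_ge0.
have phase_part := integral_cauchy_schwarz (leb n) mw mQ w0 Q0.
have radial_part := integral_cauchy_schwarz (leb n) mw mG w0 G0.
have hardy_part := hardy fC p_gt2 q_gt0 q_ltn.
set I := (\int[leb n]_x _)%E in hardy_part *.
set J := (\int[leb n]_x (w x * G x)%:E)%E in radial_part *.
have I0 : (0 <= I)%E by apply: integral_ge0 => x _; rewrite lee_fin divr_ge0 ?powR_ge0.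
have J0 : (0 <= J)%E by apply: integral_ge0 => x _; rewrite lee_fin mulr_ge0.
(* the radial part, through the weighted Hardy inequality *)
have IJ : (((n%:R - q) ^+ 2 / p ^+ 2)%:E * I ^+ 2 <= J ^+ 2)%E.
  have -> : (((n%:R - q) ^+ 2 / p ^+ 2)%:E * I ^+ 2 = (((n%:R - q) / p)%:E * I) ^+ 2)%E.
    by rewrite -expr_div_n !expe2 muleACA -EFinM -expr2.
  rewrite lee_sqr//; last first.
    by rewrite mule_ge0// lee_fin divr_ge0 ?subr_ge0 ?ltW.
  by rewrite mulrC EFinM -muleA lee_pdivrMl.
(* both parts share the factor W, and the remaining factors add up to at most
   the integral of the squared Hessian *)
rewrite integral_laplacian_sqr//.
apply: (@le_trans _ _ (W * (\int[leb n]_x (G x ^+ 2)%:E) + W * (\int[leb n]_x (Q x ^+ 2)%:E))%E).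
  by apply: leeD => //; exact: le_trans radial_part.
rewrite -ge0_muleDr; last 2 first.
- by apply: integral_ge0 => x _; rewrite lee_fin sqr_ge0.
- by apply: integral_ge0 => x _; rewrite lee_fin sqr_ge0.
rewrite muleC lee_wpmul2r// -ge0_integralD//; last 4 first.
- by move=> x _; rewrite lee_fin sqr_ge0.
- by apply/measurable_EFinP; exact: measurable_funX.
- by move=> x _; rewrite lee_fin sqr_ge0.
- by apply/measurable_EFinP; exact: measurable_funX.
apply: ge0_le_integral => //.
- by move=> x _; rewrite adde_ge0 ?lee_fin ?sqr_ge0.
- by apply: emeasurable_funD; apply/measurable_EFinP; exact: measurable_funX.
- apply/measurable_EFinP; apply: continuous_measurable_rV.
  apply: continuous_sum => j; apply: continuous_sum => k.
  by apply: continuous_mul; apply: smooth_continuous; do 2 apply: smooth_partial.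
- move=> x _; rewrite -EFinD lee_fin (le_trans (modulus_phase_split f x))//.
  rewrite le_eqVlt; apply/orP; left; apply/eqP.
  apply: eq_bigr => j _; apply: eq_bigr => k _; congr (partial k _ x ^+ 2).
  by apply/funext => y; rewrite /f mxE.
Qed.
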